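(* Let $r\ge 1$. The family of (high order) spaces $A^k(T)$ is closed under traces and the exterior derivative: for every cell $T$, every $k$ and every $u\in A^k(T)$, one has $u|_{T'}\in A^k(T')$ for every face $T'$ of $T$, and $\mathrm{d}u\in A^{k+1}(T)$.
   Context: $T$ denotes a polytope (a flat cell of a polytopal mesh) of dimension $d$, oriented and equipped with the Euclidean metric. Its faces $T'$ include $T$ itself; each face is also a cell, and is oriented. Differential forms are real valued; the trace $u|_{T'}$ of a form $u$ on a face $T'$ is its pullback by the inclusion $T' \to T$. $X^k(T)$ is the space of $k$-forms $u$ in $L^2(T)$ with $\mathrm{d}u$ in $L^2(T)$, and $X^k_0(T)=\{u\in X^k(T): u|_{\partial T}=0\}$ (so $X^d_0(T)=X^d(T)$). The pointwise scalar product of forms is $u\cdot v$; orthogonality $\perp$ is with respect to the $L^2$ scalar product; $\mathrm{d}^\star$ is the formal $L^2$-adjoint of $\mathrm{d}$. $\mathrm{P}^s\Lambda^k(T)$ is the space of polynomial $k$-forms of degree at most $s$. With $b_T$ the barycentre of $T$, $\kappa_T$ denotes contraction of forms by the vector field $x\mapsto x-b_T$, and $\mathrm{P}^s_-\Lambda^k(T)=\{u\in \mathrm{P}^s\Lambda^k(T): \kappa_T u\in \mathrm{P}^s\Lambda^{k-1}(T)\}$. Spaces of $k$-forms with $k<0$ or $k>d$ are zero. Fix $r\ge1$. For $d\geq 1$ set $$U^k(T)=\{u\in \mathrm{P}^{r+1}_-\Lambda^k(T): u\perp \mathrm{P}^r\Lambda^k(T)\},\qquad W^k(T)=\mathrm{d}U^{k-1}(T)+U^k(T),$$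 $$Z^k_0(T)=\{u\in X^k_0(T): \forall w\in W^{d-k}(T)\ \int_T u\wedge w=0\},\qquad Y^k(T)=\{u\in Z^k_0(T): u\perp \mathrm{d}Z^{k-1}_0(T)\},$$ $$G^k(T)=\{(f,g)\in \mathrm{P}^{r-1}\Lambda^k(T)\times \mathrm{P}^{r-1}\Lambda^{k-1}(T): \mathrm{d}^\star f=0,\ \mathrm{d}^\star g=0\}.$$ $B^k(T)$ is the space of $u\in X^k(T)$ for which there exist $(f,g)\in G^k(T)$, $a\in U^{d-k-1}(T)$, $b\in U^{d-k}(T)$ and $v\in Y^{k-1}(T)$ such that $$\int_T \mathrm{d}u\cdot \mathrm{d}u'+\int_T \mathrm{d}u'\wedge a+\int_T u'\wedge b+\int_T u'\cdot \mathrm{d}v=\int_T f\cdot u',$$ $$\int_T \mathrm{d}u\wedge a'=0,\quad \int_T u\wedge b'=0,\quad \int_T u\cdot \mathrm{d}v'=\int_T g\cdot v',$$ for all $u'\in X^k_0(T)$, $a'\in U^{d-k-1}(T)$, $b'\in U^{d-k}(T)$, $v'\in Y^{k-1}(T)$. For $T$ a point, $B^0(T)=\mathbb{R}$. $A^k(T)=\{u\in X^k(T): u|_{T'}\in B^k(T') \text{ for every face } T' \text{ of } T \text{ (including } T'=T)\}$. *)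

(* Defs.v *)
From HB Require Import structures.
From mathcomp Require Import all_boot all_order all_algebra.
(* Its notations clash with those of MathComp-Analysis. *)
From mathcomp Require Import -(notations) mpoly.
From mathcomp Require Import all_classical all_reals all_analysis.

Set Implicit Arguments.
Unset Strict Implicit.
Unset Printing Implicit Defensive.

Import Order.TTheory GRing.Theory Num.Theory.
Import numFieldNormedType.Exports.

Local Open Scope classical_set_scope.
Local Open Scope ring_scope.

(** * Lebesgue measure on R^d *)

Section LebesgueMeasure.
Variable R : realType.
Local Notation mR := (measurableTypeR R).

Let tuple_cons n (x : mR * n.-tuple mR) : n.+1.-tuple mR := [tuple of x.1 :: x.2].

Let measurable_tuple_cons n :
  measurable_fun [set: mR * n.-tuple mR]
    (@tuple_cons n).
Proof. exact: measurable_cons. Qed.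

Section Step.
Variables (n : nat)
  (mu : {sigma_finite_measure set (n.-tuple mR) -> \bar R}).

(** [mu] is the Lebesgue measure of R^n, [lebesgue_step] that of R^(n+1). *)
Definition lebesgue_step : set (n.+1.-tuple mR) -> \bar R :=
  pushforward (lebesgue_measure \x mu)%E (@tuple_cons n).

Let measurable_preimage_cons (A : set (n.+1.-tuple mR)) :
  measurable A -> measurable (@tuple_cons n @^-1` A).
Proof.
by move=> mA; rewrite -[X in measurable X]setTI; exact: measurable_tuple_cons.
Qed.

Let lebesgue_step0 : lebesgue_step set0 = 0%E.
Proof. by rewrite /lebesgue_step /pushforward preimage_set0 measure0. Qed.

Let lebesgue_step_ge0 A : (0 <= lebesgue_step A)%E.
Proof. by rewrite /lebesgue_step /pushforward measure_ge0. Qed.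

Let lebesgue_step_sigma_additive : semi_sigma_additive lebesgue_step.
Proof.
move=> F mF tF mUF; rewrite /lebesgue_step /pushforward preimage_bigcup.
apply: measure_semi_sigma_additive.
- by move=> i; exact: measurable_preimage_cons.
- apply/trivIsetP => /= i j _ _ ij; rewrite -preimage_setI.
  by move/trivIsetP : tF => /(_ _ _ _ _ ij) ->//; rewrite preimage_set0.
- by rewrite -preimage_bigcup; exact: measurable_preimage_cons.
Qed.

HB.instance Definition _ := isMeasure.Build _ _ _ lebesgue_step
  lebesgue_step0 lebesgue_step_ge0 lebesgue_step_sigma_additive.

Let lebesgue_step_sigma_finite : sigma_finite setT lebesgue_step.
Proof.
have [F FT mF] : sigma_finite setT (lebesgue_measure \x mu)%E.
  have /sigma_finiteP[F [TF ndF Foo]] := sigma_finiteT (@lebesgue_measure R).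
  have /sigma_finiteP[G [TG ndG Goo]] := sigma_finiteT mu.
  exists (fun n => F n `*` G n).
    rewrite -setXTT TF TG predeqE => -[x y]; split.
      move=> [/= [i _ Fix] [k _ Gky]]; exists (maxn i k) => //; split.
      - by move: x Fix; exact/subsetPset/ndF/leq_maxl.
      - by move: y Gky; exact/subsetPset/ndG/leq_maxr.
    by move=> [i _ []/= ? ?]; split; exists i.
  move=> k; have [? ?] := Foo k; have [? ?] := Goo k.
  split; first exact: measurableX.
  by rewrite product_measure1E// lte_mul_pinfty// ge0_fin_numE.
pose un (t : n.+1.-tuple mR) :
  mR * n.-tuple mR :=
  (thead t, [tuple of behead t]).
have munb : measurable_fun setT un.
  apply/measurable_fun_pairP; split.
    exact: (measurable_tnth ord0).
  exact: measurable_behead.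
have unK x : un (tuple_cons x) = x.
  by case: x => a t; rewrite /un /tuple_cons /= theadE; congr pair; apply: val_inj.
exists (fun i => un @^-1` F i).
  by rewrite -preimage_bigcup -FT preimage_setT.
move=> i; have [mFi Fi] := mF i; split.
  by rewrite -[X in measurable X]setTI; exact: munb.
rewrite /lebesgue_step /pushforward -comp_preimage.
suff -> : (un \o @tuple_cons n) @^-1` F i = F i by [].
by apply/seteqP; split=> x /=; rewrite unK.
Qed.

HB.instance Definition _ :=
  Measure_isSigmaFinite.Build _ _ _ lebesgue_step lebesgue_step_sigma_finite.

End Step.

Fixpoint lebesgue_tuple (n : nat) :
    {sigma_finite_measure set (n.-tuple mR) -> \bar R} :=
  match n with
  | 0 => \d_([tuple] : 0.-tuple mR)
  | n.+1 => lebesgue_step (lebesgue_tuple n)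
  end.

End LebesgueMeasure.

(** * Exterior algebra of R^d and differential forms on R^d *)

(** [a I] is the coefficient of dx_{i_1} /\ ... /\ dx_{i_k}, where
    I = {i_1 < ... < i_k}.  Degrees are integers ([homog]), so that the forms of
    degree [k < 0] or [k > d] are exactly the zero forms. *)
Definition ext (R : realType) (d : nat) := {ffun {set 'I_d} -> R}.

Section ExteriorAlgebra.
Variable R : realType.

Definition homog d (k : int) (a : ext R d) : Prop :=
  forall I : {set 'I_d}, (#|I|)%:Z != k -> a I = 0.

(** The sign such that dx_I /\ dx_J = [shuffle_sign I J] dx_{I u J} for
    disjoint I and J. *)
Definition shuffle_sign d (I J : {set 'I_d}) : R :=
  (-1) ^+ #|[set p : 'I_d * 'I_d | [&& p.1 \in I, p.2 \in J & (p.2 < p.1)%N]]|.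

Definition wedge d (a b : ext R d) : ext R d :=
  [ffun K : {set 'I_d} => \sum_(I : {set 'I_d} | I \subset K)
     shuffle_sign I (K :\: I) * a I * b (K :\: I)].

Definition ext_one d : ext R d := [ffun I : {set 'I_d} => (I == finset.set0)%:R].

Definition volume_form d : ext R d :=
  [ffun I : {set 'I_d} => (I == [set: 'I_d]%SET)%:R].

Definition covector d (c : 'I_d -> R) : ext R d :=
  [ffun J : {set 'I_d} => \sum_(j < d) (J == [set j]%SET)%:R * c j].

(** The basis (dx_I) is orthonormal. *)
Definition ext_dot d (a b : ext R d) : R := \sum_(I : {set 'I_d}) a I * b I.

Definition contract d (v : 'rV[R]_d) (a : ext R d) : ext R d :=
  [ffun J : {set 'I_d} => \sum_(i < d | i \notin J)
     shuffle_sign [set i]%SET J * v ord0 i * a (i |: J)%SET].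

(** Pullback by the linear map [x |-> x *m L] from R^m to R^d: the algebra
    morphism sending dy_i to \sum_j L_(j, i) dx_j ([enum I] is increasing). *)
Definition ext_pull m d (L : 'M[R]_(m, d)) (a : ext R d) : ext R m :=
  \sum_(I : {set 'I_d})
    a I *: \big[@wedge m / ext_one m]_(i <- enum I) covector (fun j => L j i).

Definition form d := 'rV[R]_d -> ext R d.

Definition fzero d : form d := fun=> 0.

Definition basis_vec d (i : 'I_d) : 'rV[R]_d := delta_mx ord0 i.

Definition ext_d d (u : form d) : form d := fun x =>
  [ffun K : {set 'I_d} => \sum_(i in K)
     shuffle_sign [set i]%SET (K :\ i)%SET *
     derive (fun y => u y (K :\ i)%SET) x (basis_vec i)].

Fixpoint Cm (m : nat) d (f : 'rV[R]_d -> R) : Prop :=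
  match m with
  | 0 => continuous f
  | m.+1 => continuous f /\ forall i : 'I_d,
      (forall x, derivable f x (basis_vec i)) /\
      Cm m (fun x => derive f x (basis_vec i))
  end.

Definition smooth d (u : form d) : Prop :=
  forall (I : {set 'I_d}) (m : nat), Cm m (fun x => u x I).

Definition poly_fun (s : nat) d (f : 'rV[R]_d -> R) : Prop :=
  exists p : mpoly d R,
    (msize p <= s.+1)%N /\
    forall x, f x = meval (fun i => x ord0 i) p.

(** P^s Lambda^k *)
Definition poly_form (s : nat) d (k : int) (u : form d) : Prop :=
  (forall x, homog k (u x)) /\ forall I : {set 'I_d}, poly_fun s (fun x => u x I).

End ExteriorAlgebra.

Arguments fzero {R d}.
Arguments volume_form R d : clear implicits.

(** * Cells and polytopal meshes *)

Unset Implicit Arguments.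

Section Cells.
Context {R : realType}.

Definition conv {d} (s : seq 'rV[R]_d) : set 'rV[R]_d :=
  [set x | exists a : 'I_(size s) -> R,
    [/\ forall i, 0 <= a i, \sum_i a i = 1 & x = \sum_i a i *: s`_i]].

(** An oriented polytope of dimension [cell_dim] in R^n.  The isometry
    [x |-> cell_origin + x *m cell_frame] identifies R^cell_dim, with its standard
    orientation and inner product, with the oriented affine span of the polytope;
    [body] is the polytope in these coordinates, in which all forms on it are
    written. *)
Record cell (n : nat) := Cell {
  cell_dim : nat;
  cell_vertices : seq 'rV[R]_cell_dim;
  cell_origin : 'rV[R]_n;
  cell_frame : 'M[R]_(cell_dim, n);
  cell_frame_orthonormal : cell_frame *m cell_frame^T = 1%:M;
  cell_full_dim : interior (conv cell_vertices) !=set0 }.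

Arguments cell_dim {n}.
Arguments cell_vertices {n}.
Arguments cell_origin {n}.
Arguments cell_frame {n}.

Definition body {n} (T : cell n) : set 'rV[R]_(cell_dim T) := conv (cell_vertices T).

Definition chart {n} (T : cell n) (x : 'rV[R]_(cell_dim T)) : 'rV[R]_n :=
  cell_origin T + x *m cell_frame T.

Definition cell_support {n} (T : cell n) : set 'rV[R]_n := chart T @` body T.

(** Nonempty faces, the polytope itself included ([c = 0]). *)
Definition is_face {n} (F P : set 'rV[R]_n) : Prop :=
  F !=set0 /\ exists c : 'cV[R]_n,
    F = [set x | P x /\ forall y, P y -> (y *m c) ord0 ord0 <= (x *m c) ord0 ord0].

Definition face {n} (F T : cell n) : Prop := is_face (cell_support F) (cell_support T).

Definition facet {n} (F T : cell n) : Prop := face F T /\ cell_dim T = (cell_dim F).+1.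

Record mesh (n : nat) := Mesh {
  mesh_cell :> Type;
  geom : mesh_cell -> cell n;
  geom_inj : forall S T, cell_support (geom S) = cell_support (geom T) -> S = T;
  mesh_faces : forall T F, is_face F (cell_support (geom T)) ->
    exists S, cell_support (geom S) = F;
  mesh_inter : forall S T, cell_support (geom S) `&` cell_support (geom T) !=set0 ->
    is_face (cell_support (geom S) `&` cell_support (geom T)) (cell_support (geom S)) /\
    is_face (cell_support (geom S) `&` cell_support (geom T)) (cell_support (geom T)) }.

(** For F contained in the affine span of T, the map from F-coordinates to
    T-coordinates, and its linear part. *)
Definition trans {n} (F T : cell n) (x : 'rV[R]_(cell_dim F)) : 'rV[R]_(cell_dim T) :=
  (chart F x - cell_origin T) *m (cell_frame T)^T.

Definition trans_lin {n} (F T : cell n) : 'M[R]_(cell_dim F, cell_dim T) :=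
  cell_frame F *m (cell_frame T)^T.

(** Pullback by the inclusion of F in T. *)
Definition smooth_trace {n} (F T : cell n) (u : form R (cell_dim T)) : form R (cell_dim F) :=
  fun x => ext_pull (trans_lin F T) (u (trans F T x)).

Definition vec_of_tuple {d} (t : d.-tuple (measurableTypeR R)) : 'rV[R]_d :=
  \row_i tnth t i.

Definition tuple_body {n} (T : cell n) : set ((cell_dim T).-tuple (measurableTypeR R)) :=
  vec_of_tuple @^-1` body T.

Definition cell_int {n} (T : cell n) (f : 'rV[R]_(cell_dim T) -> R) : R :=
  \int[lebesgue_tuple R (cell_dim T)]_(t in tuple_body T) f (vec_of_tuple t).

Definition barycentre {n} (T : cell n) : 'rV[R]_(cell_dim T) :=
  \row_i (cell_int T (fun x => x ord0 i) / cell_int T (fun=> 1)).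

(** For a facet F of T, the sign of the orientation of F with respect to the
    boundary orientation of T (outward vector first); [b_F - b_T] points
    outward along F. *)
Definition incidence {n} (F T : cell n) : R :=
  Num.sg (ext_pull (trans_lin F T)
    (contract (trans F T (barycentre F) - barycentre T) (volume_form R (cell_dim T)))
    [set: 'I_(cell_dim F)]%SET).

(** \int_T u /\ v: the integral of the component of degree [cell_dim T]. *)
Definition int_wedge {n} (T : cell n) (u v : form R (cell_dim T)) : R :=
  cell_int T (fun x => wedge (u x) (v x) [set: 'I_(cell_dim T)]%SET).

(** \int_T u . v *)
Definition int_dot {n} (T : cell n) (u v : form R (cell_dim T)) : R :=
  cell_int T (fun x => ext_dot (u x) (v x)).

(** * The spaces X^k(T) and X^k_0(T) *)

Definition L2_form {n} (T : cell n) (k : int) (u : form R (cell_dim T)) : Prop :=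
  (forall x, homog k (u x)) /\
  forall I : {set 'I_(cell_dim T)},
    measurable_fun (tuple_body T) (fun t => u (vec_of_tuple t) I) /\
    (lebesgue_tuple R (cell_dim T)).-integrable (tuple_body T)
      (fun t => ((u (vec_of_tuple t) I) ^+ 2)%:E).

Definition bdry {n} (T : cell n) : set 'rV[R]_(cell_dim T) := body T `\` interior (body T).

(** Smooth forms vanishing near S.  On T, those vanishing near the boundary of
    T are the smooth forms with compact support in the interior of T. *)
Definition test_form {d} (S : set 'rV[R]_d) (phi : form R d) : Prop :=
  smooth phi /\ exists O : set 'rV[R]_d,
    [/\ open O, S `<=` O & forall x, O x -> phi x = 0].

(** The space X^k(T) is identified with the graph of the weak exterior
    derivative: an element is a form [val_of] together with a representative
    [der] of its weak derivative (which is determined up to null sets). *)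
Record wform (d : nat) := WForm { val_of :> form R d; der : form R d }.

Arguments WForm {d}.
Arguments der {d}.

Definition wform_d {d} (u : wform d) : wform d := WForm (der u) fzero.

(** \int_T du /\ phi + (-1)^k \int_T u /\ d phi, i.e. \int_T d(u /\ phi). *)
Definition green {n} (T : cell n) (k : int) (u : wform (cell_dim T))
    (phi : form R (cell_dim T)) : R :=
  int_wedge T (der u) phi + (-1) ^ k * int_wedge T u (ext_d phi).

Definition space_X {n} (T : cell n) (k : int) (u : wform (cell_dim T)) : Prop :=
  [/\ L2_form T k u, L2_form T (k + 1) (der u) &
      forall phi, test_form (bdry T) phi -> green T k u phi = 0].

(** The trace on the whole boundary is zero in the sense of Stokes' formula. *)
Definition space_X0 {n} (T : cell n) (k : int) (u : wform (cell_dim T)) : Prop :=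
  space_X T k u /\ forall phi, smooth phi -> green T k u phi = 0.

(** The trace of u on a facet F is w: Stokes' formula holds for the forms
    vanishing near the rest of the boundary. *)
Definition facet_trace {n} (T F : cell n) (k : int)
    (u : wform (cell_dim T)) (w : wform (cell_dim F)) : Prop :=
  forall phi, test_form (bdry T `\` (trans F T @` interior (body F))) phi ->
    green T k u phi =
    incidence F T * int_wedge F w (smooth_trace F T phi).

(** * The local spaces *)

(** [h] is the formal adjoint of d applied to [f]. *)
Definition weak_codiff {n} (T : cell n) (f h : form R (cell_dim T)) : Prop :=
  forall phi, test_form (bdry T) phi ->
    int_dot T h phi = int_dot T f (ext_d phi).

Definition koszul {n} (T : cell n) (u : form R (cell_dim T)) : form R (cell_dim T) :=
  fun x => contract (x - barycentre T) (u x).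

Definition poly_form_minus {n} (T : cell n) (s : nat) (k : int)
    (u : form R (cell_dim T)) : Prop :=
  poly_form s k u /\ poly_form s (k - 1) (koszul T u).

Definition space_U {n} (r : nat) (T : cell n) (k : int) (u : form R (cell_dim T)) : Prop :=
  poly_form_minus T r.+1 k u /\
  forall p, poly_form r k p -> int_dot T u p = 0.

Definition space_W {n} (r : nat) (T : cell n) (k : int) (w : form R (cell_dim T)) : Prop :=
  exists a b, [/\ space_U r T (k - 1) a, space_U r T k b &
                  forall x, w x = ext_d a x + b x].

Definition space_Z0 {n} (r : nat) (T : cell n) (k : int) (u : wform (cell_dim T)) : Prop :=
  space_X0 T k u /\
  forall w, space_W r T ((cell_dim T)%:Z - k) w -> int_wedge T u w = 0.

Definition space_Y {n} (r : nat) (T : cell n) (k : int) (u : wform (cell_dim T)) : Prop :=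
  space_Z0 r T k u /\
  forall z, space_Z0 r T (k - 1) z -> int_dot T u (der z) = 0.

Definition space_G {n} (r : nat) (T : cell n) (k : int) (f g : form R (cell_dim T)) : Prop :=
  [/\ poly_form r.-1 k f, poly_form r.-1 (k - 1) g,
      weak_codiff T f fzero & weak_codiff T g fzero].

(** For T a point, [space_X T k] is R if k = 0 and zero otherwise. *)
Definition space_B {n} (r : nat) (T : cell n) (k : int) (u : wform (cell_dim T)) : Prop :=
  space_X T k u /\
  ((0 < cell_dim T)%N ->
   exists (f g a b : form R (cell_dim T)) (v : wform (cell_dim T)),
   [/\ space_G r T k f g,
       space_U r T ((cell_dim T)%:Z - k - 1) a,
       space_U r T ((cell_dim T)%:Z - k) b,
       space_Y r T (k - 1) v &
   [/\ forall u' : wform (cell_dim T), space_X0 T k u' ->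
         int_dot T (der u) (der u') + int_wedge T (der u') a +
         int_wedge T u' b + int_dot T u' (der v) =
         int_dot T f u',
       forall a', space_U r T ((cell_dim T)%:Z - k - 1) a' ->
         int_wedge T (der u) a' = 0,
       forall b', space_U r T ((cell_dim T)%:Z - k) b' ->
         int_wedge T u b' = 0 &
       forall v' : wform (cell_dim T), space_Y r T (k - 1) v' ->
         int_dot T u (der v') = int_dot T g v']]).

End Cells.

Arguments cell : clear implicits.
Arguments mesh : clear implicits.
Arguments wform : clear implicits.
Arguments cell_dim {R n}.
Arguments cell_vertices {R n}.
Arguments cell_origin {R n}.
Arguments cell_frame {R n}.
Arguments WForm {R d}.
Arguments der {R d}.
Arguments geom {R n m}.

Coercion geom : mesh_cell >-> cell.

(** * Traces on all faces, and the spaces A^k(T) *)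

Section GlobalSpaces.
Context {R : realType} {n : nat} {M : mesh R n}.

(** [w F] is the trace of [u] on F, for every face F of T (unique up to null
    sets); traces on faces of higher codimension are iterated traces on facets. *)
Definition traces (T : M) (k : int) (u : wform R (cell_dim T))
    (w : forall F : M, wform R (cell_dim F)) : Prop :=
  [/\ w T = u,
      forall F : M, face F T -> space_X F k (w F) &
      forall F E : M, face F T -> facet E F ->
        facet_trace F E k (w F) (w E)].

Definition space_A (r : nat) (T : M) (k : int) (u : wform R (cell_dim T)) : Prop :=
  exists w, traces T k u w /\
    forall F : M, face F T -> space_B r F k (w F).

End GlobalSpaces.

(* Main.v *)
Require Import Defs.
From mathcomp Require Import all_boot all_order all_algebra.
From mathcomp Require Import -(notations) mpoly.
From mathcomp Require Import all_classical all_reals all_analysis.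
From mathcomp Require Import ring.
(* Imported again because the algebra library has its own [form]. *)
Require Import Defs.

(** The spaces A^k(T) are closed under traces because their conditions are
    imposed on all faces at once: the traces of u on the faces of a face F are
    traces of u on faces of T.  What has to be checked is that a face of a face
    of T is a face of T, and in a mesh this follows from the fact that two cells
    meet in a common face ([face_trans]).

    For the exterior derivative, the family of the traces of du is the family
    of the derivatives of the traces of u.  Three facts make this work.

    - du has weak derivative 0: Stokes' formula for u against d phi, where
      d d phi = 0, is the formula for du against phi ([space_X_wform_d]).
      Smoothness being defined by iterated partial derivatives, d d = 0 rests
      on the symmetry of second partial derivatives ([derive_swap]), itself a
      consequence of the mean value theorem.

    - The traces of du on facets are the derivatives of the traces of u
      ([facet_trace_wform_d]).  If phi vanishes near the part of the boundary
      of F outside the facet E, then so does d phi, so that Stokes' formula on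
      F for u and d phi gives an integral over E of u|_E against the trace of
      d phi.  The trace of d phi is d of the trace of phi
      ([ext_d_affine_pull]), and the trace of phi vanishes near the boundary
      of E ([test_form_trace]); integrating by parts on E moves d onto u|_E.
      That pullbacks commute with d combines the chain rule for functions with
      continuous partial derivatives ([is_derive_dir_partials]) and the
      anticommutation of covectors in the exterior algebra
      ([wedge_pull_basis]).

    - d maps B^k(F) to B^(k+1)(F) ([space_B_wform_d]).  If (f, g), a, b, v are
      the data of u, then (0, f), 0, 0, 0 are data for du.  The only condition
      that is not immediate is that du and f have the same products with dv'
      and v' for v' in Y^k(F).  It is the first equation of u tested with
      u' = v': there the terms with a and b vanish since v' is annihilated by
      W^(d-k)(F), after an integration by parts for the one with a, and the
      term with dv vanishes since v' is orthogonal to d Z_0^(k-1)(F). *)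

Set Implicit Arguments.
Unset Strict Implicit.
Unset Printing Implicit Defensive.

Import Order.TTheory GRing.Theory Num.Theory.
Import numFieldNormedType.Exports.

Local Open Scope ring_scope.

(** * Directional derivatives *)

Section Line.
Local Open Scope classical_set_scope.
Variables (R : realType) (V : normedModType R).
Implicit Types (f : V -> R) (x v w : V).

(** The derivative of f along v is the derivative of its restriction to a line,
    because the difference quotients are the same. *)
Lemma growth_rate_line f v x (s : R) :
  (fun h : R => h^-1 *: (((fun t => f (x + t *: v)) \o shift s) (h *: 1) -
                         f (x + s *: v))) =
  (fun h : R => h^-1 *: ((f \o shift (x + s *: v)) (h *: v) - f (x + s *: v))).
Proof.
apply: funext => h; congr (_ *: (f _ - _)).
by rewrite /= [h *: 1]mulr1 scalerDl addrCA addrA.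
Qed.

Lemma is_derive_line f v x (s : R) : derivable f (x + s *: v) v ->
  is_derive s 1 (fun t : R => f (x + t *: v)) ('D_v f (x + s *: v)).
Proof.
move=> d; split; first by rewrite /derivable growth_rate_line.
by rewrite /derive growth_rate_line.
Qed.

Lemma is_derive_scale_dir f x v (c : R) :
  derivable f x v -> is_derive x (c *: v) f (c * 'D_v f x).
Proof.
move=> d.
pose g (t : R) := f (x + t *: v).
have dg : is_derive (c * 0 : R) 1 g ('D_v f x).
  rewrite mulr0 -[x in 'D_v f x]addr0 -(scale0r v); apply: is_derive_line.
  by rewrite scale0r addr0.
have [dgc Dgc] : is_derive (0 : R) 1 (g \o ( *%R c)) (c * 'D_v f x).
  rewrite mulrC; apply: is_derive1_comp.
  by rewrite -[X in is_derive _ _ _ X]mulr1; exact: (@is_deriveZ R R R id c 0 1 1).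
have E : (fun t : R => f (x + t *: (c *: v))) = g \o ( *%R c).
  by apply: funext => t; rewrite /g /= scalerA [t * c]mulrC.
have := growth_rate_line f (c *: v) x 0; rewrite E !scale0r !addr0 => G.
have g0 : f x = (g \o ( *%R c)) 0 by rewrite /g /= mulr0 scale0r addr0.
split; first by rewrite /derivable -G g0.
by rewrite -Dgc /derive -G g0.
Qed.

Lemma MVT_dir f x v : (forall y, derivable f y v) ->
  exists2 s : R, 0 <= s <= 1 & f (x + v) - f x = 'D_v f (x + s *: v).
Proof.
move=> df.
have dl (t : R) := is_derive_line (df (x + t *: v)).
have [|s s01 E] := @MVT_segment R (fun t : R => f (x + t *: v))
   (fun t : R => 'D_v f (x + t *: v)) 0 1 ler01.
  by apply: derivable_within_continuous => t _; have [] := dl t.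
exists s; first by move: s01; rewrite in_itv.
by rewrite subr0 mulr1 scale1r scale0r addr0 in E.
Qed.

Lemma MVT_dir_scale f x v (h : R) : (forall y, derivable f y v) ->
  exists2 s : R, 0 <= s <= 1 &
    f (x + h *: v) - f x = h * 'D_v f (x + (s * h) *: v).
Proof.
move=> df; have [|s s01 ->] := @MVT_dir f x (h *: v).
  by move=> y; have [] := is_derive_scale_dir h (df y).
exists s => //; rewrite scalerA.
by have [_ ->] := is_derive_scale_dir h (df (x + (s * h) *: v)).
Qed.

(** The intermediate points given by the mean value theorem, at distance O(h)
    from x, converge to x whatever their position. *)
Lemma cvg_bounded_steps (s t : R -> R) x v w :
  (forall h, `|s h| <= 1) -> (forall h, `|t h| <= 1) ->
  x + (s h * h) *: v + (t h * h) *: w @[h --> (0 : R)^'] --> x.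
Proof.
have step (r : R -> R) : (forall h, `|r h| <= 1) -> r h * h @[h --> (0 : R)^'] --> (0 : R).
  move=> r1; apply/cvgr0Pnorm_le => e e0.
  near=> h; rewrite normrM (le_trans (ler_piMl _ (r1 h)))//.
  have : `|h| < e by near: h; apply: dnbhs0_lt.
  by move/ltW.
move=> s1 t1; rewrite -[X in _ --> X](_ : x + (0 : R) *: v + (0 : R) *: w = x); last first.
  by rewrite !scale0r !addr0.
apply: cvgD; [apply: cvgD; first exact: cvg_cst|]; apply: cvgZr_tmp; exact: step.
Unshelve. all: by end_near. Qed.

(** The increment along h (v + w) is the increment along h w followed by one
    along h v.  The mean value theorem turns the second one into a value of
    ['D_v f] near x, so that continuity is used in one of the two directions only. *)
Lemma is_derive_add_dir f x v w :
  (forall y, derivable f y v) -> continuous ('D_v f) -> derivable f x w ->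
  is_derive x (v + w) f ('D_v f x + 'D_w f x).
Proof.
move=> dv cv dw.
have /choice[s sP] (h : R) : exists s : R, `|s| <= 1 /\
    f (x + h *: w + h *: v) - f (x + h *: w) = h * 'D_v f (x + h *: w + (s * h) *: v).
  have [s /andP[s0 s1] E] := MVT_dir_scale (x + h *: w) h dv.
  by exists s; split => //; rewrite ger0_norm.
suff L : (fun h : R => h^-1 *: ((f \o shift x) (h *: (v + w)) - f x)) @ 0^' -->
    'D_v f x + 'D_w f x.
  by split; [apply/cvg_ex; eexists; exact: L|exact: cvg_lim L].
have L1 : 'D_v f (x + (1 * h) *: w + (s h * h) *: v) +
     h^-1 *: ((f \o shift x) (h *: w) - f x) @[h --> (0 : R)^'] --> 'D_v f x + 'D_w f x.
  apply: cvgD; last exact: dw.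
  apply: (cvg_comp _ _ (@cvg_bounded_steps (fun=> 1) s x w v _ _) (cv x)).
    by move=> h; rewrite normr1.
  by move=> h; case: (sP h).
apply: cvg_trans L1; apply: near_eq_cvg; near=> h.
have h0 : h != 0 by near: h; exact: nbhs_dnbhs_neq.
rewrite mul1r /= -[X in X + _](mulKf h0) -(sP h).2 -[X in X + _]/(h^-1 *: _) -scalerDr.
rewrite [h *: w + x]addrC addrA subrK; congr (_ *: (f _ - _)).
by rewrite scalerDr [RHS]addrC [h *: v + _]addrC addrA.
Unshelve. all: by end_near. Qed.

(** Symmetry of second derivatives.  The second difference of f over the
    parallelogram with sides h v and h w is symmetric in v and w; two mean value
    theorems express it by either iterated derivative at a point near x. *)
Lemma derive_swap f x v w :
  (forall y, derivable f y v) -> (forall y, derivable f y w) ->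
  (forall y, derivable ('D_v f) y w) -> (forall y, derivable ('D_w f) y v) ->
  continuous ('D_w ('D_v f)) -> continuous ('D_v ('D_w f)) ->
  'D_w ('D_v f) x = 'D_v ('D_w f) x.
Proof.
have key v' w' : (forall y, derivable f y v') -> (forall y, derivable ('D_v' f) y w') ->
    forall h : R, exists s : R * R, [/\ `|s.1| <= 1, `|s.2| <= 1 &
      f (x + h *: v' + h *: w') - f (x + h *: v') - f (x + h *: w') + f x =
      h * (h * 'D_w' ('D_v' f) (x + (s.1 * h) *: v' + (s.2 * h) *: w'))].
  move=> dv dvw h.
  have dg y : is_derive y v' (fun z => f (z + h *: w') - f z) ('D_v' f (y + h *: w') - 'D_v' f y).
    have E : (fun a : R => a^-1 *: (((fun z => f (z + h *: w')) \o shift y) (a *: v') -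
                         f (y + h *: w'))) =
       (fun a : R => a^-1 *: ((f \o shift (y + h *: w')) (a *: v') - f (y + h *: w'))).
      by apply: funext => a; congr (_ *: (f _ - _)); rewrite /= addrA.
    have [d1 D1] : is_derive y v' (fun z => f (z + h *: w')) ('D_v' f (y + h *: w')).
      split; first by rewrite /derivable E; exact: dv.
      by rewrite /derive E.
    by rewrite -D1; exact: (is_deriveB (derivableP d1) (derivableP (dv y))).
  have [|s /andP[s0 s1] E1] := @MVT_dir_scale (fun z => f (z + h *: w') - f z) x v' h.
    by move=> y; case: (dg y).
  have [t /andP[t0 t1] E2] := MVT_dir_scale (x + (s * h) *: v') h dvw.
  exists (s, t); split; rewrite ?ger0_norm//=.
  have [_ Dg] := dg (x + (s * h) *: v').
  by rewrite -E2 -Dg -E1 opprB [RHS]addrA [RHS]addrAC.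
move=> dv dw dvw dwv cvw cwv.
have /choice[p pP] := key v w dv dvw.
have /choice[q qP] := key w v dw dwv.
have L1 : 'D_w ('D_v f) (x + ((p h).1 * h) *: v + ((p h).2 * h) *: w)
    @[h --> (0 : R)^'] --> 'D_w ('D_v f) x.
  by apply: (cvg_comp _ _ (@cvg_bounded_steps (fun h => (p h).1) (fun h => (p h).2)
    x v w _ _) (cvw x)) => h; case: (pP h).
have L2 : 'D_v ('D_w f) (x + ((q h).1 * h) *: w + ((q h).2 * h) *: v)
    @[h --> (0 : R)^'] --> 'D_v ('D_w f) x.
  by apply: (cvg_comp _ _ (@cvg_bounded_steps (fun h => (q h).1) (fun h => (q h).2)
    x w v _ _) (cwv x)) => h; case: (qP h).
have H : hausdorff_space R by exact: norm_hausdorff.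
refine (cvg_unique H L1 _).
apply: cvg_trans L2; apply: near_eq_cvg; near=> h.
have h0 : h != 0 by near: h; exact: nbhs_dnbhs_neq.
apply: (mulfI h0); apply: (mulfI h0).
have [_ _ pE] := pP h; have [_ _ qE] := qP h; rewrite -[LHS]qE -[RHS]pE.
by rewrite [f _ - _ - _]addrAC [x + h *: w + _]addrAC.
Unshelve. all: by end_near. Qed.

Lemma is_derive_lincomb (I : Type) (s : seq I) (P : pred I)
    (c : I -> R) (f : I -> V -> R) x v : (forall i, derivable (f i) x v) ->
  is_derive x v (fun y => \sum_(i <- s | P i) c i * f i y)
    (\sum_(i <- s | P i) c i * 'D_v (f i) x).
Proof.
move=> df; elim: s => [|i s IH].
  rewrite big_nil (_ : (fun y => _) = cst 0); first exact: is_derive_cst.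
  by apply: funext => y; rewrite big_nil.
pose g y := \sum_(j <- s | P j) c j * f j y.
rewrite big_cons (_ : (fun y => _) = if P i then (c i \*: f i) + g else g); last first.
  by apply: funext => y; rewrite big_cons; case: (P i).
case: (P i) => //; apply: is_deriveD; exact: is_deriveZ (derivableP (df i)).
Qed.

End Line.

(** * Calculus of iterated partial derivatives *)

Section Smooth.
Local Open Scope classical_set_scope.
Variable R : realType.

Lemma continuous_add (T : topologicalType) (V : normedModType R) (f g : T -> V) :
  continuous f -> continuous g -> continuous (fun x => f x + g x).
Proof. by move=> cf cg x; apply: cvgD; [exact: cf|exact: cg]. Qed.

Lemma continuous_scalel (T : topologicalType) (V : normedModType R) (f : T -> R) (v : V) :
  continuous f -> continuous (fun x => f x *: v).
Proof. by move=> cf x; apply: cvgZr_tmp; exact: cf. Qed.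

Lemma continuous_comp_fun (T U W : topologicalType) (f : T -> U) (g : U -> W) :
  continuous f -> continuous g -> continuous (fun x => g (f x)).
Proof. by move=> cf cg x; apply: continuous_comp; [exact: cf|exact: cg]. Qed.

Lemma continuous_mul (T : topologicalType) (f g : T -> R) :
  continuous f -> continuous g -> continuous (fun x => f x * g x).
Proof. by move=> cf cg x; apply: cvgM; [exact: cf|exact: cg]. Qed.

(** Adding one coordinate direction at a time, continuous partial derivatives
    determine all the directional derivatives. *)
Lemma is_derive_dir_partials d (f : 'rV[R]_d -> R) (x v : 'rV[R]_d) :
  (forall i y, derivable f y (basis_vec R i)) ->
  (forall i, continuous ('D_(basis_vec R i) f)) ->
  is_derive x v f (\sum_i v ord0 i * 'D_(basis_vec R i) f x).
Proof.
move=> df cf; rewrite {1}(row_sum_delta v).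
elim: (index_enum _) => [|i s IH]; first by rewrite !big_nil; exact: is_derive0.
rewrite !big_cons.
have dv y := is_derive_scale_dir (v ord0 i) (df i y).
have E : 'D_(v ord0 i *: basis_vec R i) f = fun y => v ord0 i * 'D_(basis_vec R i) f y.
  by apply: funext => y; have [_] := dv y.
have [dw <-] := IH; have [_ <-] := dv x.
apply: (@is_derive_add_dir _ _ f x (v ord0 i *: basis_vec R i) _ _ _ dw).
  by move=> y; have [] := dv y.
by rewrite E; apply: continuous_mul (cf i); exact: cst_continuous.
Qed.

Lemma Cm_continuous m d (f : 'rV[R]_d -> R) : Cm m f -> continuous f.
Proof. by case: m => //= m []. Qed.

(** Derivatives of explicit functions come out in pointwise form; this lemma
    replaces a function by such an expression. *)
Lemma eq_Cm m d (f g : 'rV[R]_d -> R) : f =1 g -> Cm m g -> Cm m f.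
Proof. by move=> /funext ->. Qed.

Lemma CmW m d (f : 'rV[R]_d -> R) : Cm m.+1 f -> Cm m f.
Proof.
elim: m f => [|m IH] f; first exact: Cm_continuous.
by move=> [cf df]; split => // i; have [? ?] := df i; split => //; apply: IH.
Qed.

Lemma Cm_cst m d (c : R) : Cm m (fun _ : 'rV[R]_d => c).
Proof.
elim: m c => [|m IH] c /=; first exact: cst_continuous.
split; first exact: cst_continuous.
move=> i; split=> [x|]; first exact: derivable_cst.
by apply: (eq_Cm _ (IH 0)) => x; exact: derive_cst.
Qed.

Lemma Cm_coord m d (i : 'I_d) : Cm m (fun x : 'rV[R]_d => x ord0 i).
Proof.
have D (x v : 'rV[R]_d) : is_derive x v (fun y : 'rV[R]_d => y ord0 i) (v ord0 i).
  suff L : (fun h : R => h^-1 *: (((fun y : 'rV[R]_d => y ord0 i) \o shift x) (h *: v)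
      - x ord0 i)) @ 0^' --> (v ord0 i : R).
    by split; [apply/cvg_ex; eexists; exact: L|exact: cvg_lim L].
  apply: (@cvg_trans _ ((fun=> v ord0 i) @ (0 : R)^')); last exact: cvg_cst.
  apply: near_eq_cvg; near=> h.
  have h0 : h != 0 by near: h; exact: nbhs_dnbhs_neq.
  by rewrite /= !mxE addrK -[X in _ = X]/(h^-1 * _) mulKf.
have C : continuous (fun x : 'rV[R]_d => x ord0 i) by exact: coord_continuous.
case: m => [|m] //=; split => // j; split=> [x|]; first by have [] := D x (basis_vec R j).
apply: (@eq_Cm m d _ (fun=> basis_vec R j ord0 i)) => [x|]; last exact: Cm_cst.
by have [_ ->] := D x (basis_vec R j).
Unshelve. all: by end_near. Qed.

Lemma CmD m d (f g : 'rV[R]_d -> R) : Cm m f -> Cm m g -> Cm m (fun x => f x + g x).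
Proof.
elim: m f g => [|m IH] f g /=; first exact: continuous_add.
move=> [cf df] [cg dg]; split; first exact: continuous_add.
move=> i; have [df1 df2] := df i; have [dg1 dg2] := dg i; split=> [x|].
  exact: derivableD.
by apply: (eq_Cm _ (IH _ _ df2 dg2)) => x; rewrite deriveD.
Qed.

Lemma CmM m d (f g : 'rV[R]_d -> R) : Cm m f -> Cm m g -> Cm m (fun x => f x * g x).
Proof.
elim: m f g => [|m IH] f g; first exact: continuous_mul.
move=> cf cg; split; first by apply: continuous_mul; exact: (@Cm_continuous m.+1).
move=> i; have [df1 df2] := cf.2 i; have [dg1 dg2] := cg.2 i; split=> [x|].
  exact: derivableM.
apply: (@eq_Cm _ _ _ (fun x => f x * 'D_(basis_vec R i) g x + g x * 'D_(basis_vec R i) f x)).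
  by move=> x; rewrite deriveM.
by apply: CmD; apply: IH => //; exact: CmW.
Qed.

Lemma Cm_sum m d (I : Type) (s : seq I) (P : pred I) (f : I -> 'rV[R]_d -> R) :
  (forall i, Cm m (f i)) -> Cm m (fun x => \sum_(i <- s | P i) f i x).
Proof.
move=> Cf; elim: s => [|i s IH].
  by apply: (eq_Cm _ (@Cm_cst m d 0)) => x; rewrite big_nil.
apply: (@eq_Cm _ _ _ (fun x => (if P i then f i x else 0) + \sum_(j <- s | P j) f j x)).
  by move=> x; rewrite big_cons; case: (P i); rewrite ?add0r.
by apply: CmD => //; case: (P i) => //; exact: Cm_cst.
Qed.

Lemma Cm_prod m d (I : Type) (s : seq I) (f : I -> 'rV[R]_d -> R) :
  (forall i, Cm m (f i)) -> Cm m (fun x => \prod_(i <- s) f i x).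
Proof.
move=> Cf; elim: s => [|i s IH].
  by apply: (eq_Cm _ (@Cm_cst m d 1)) => x; rewrite big_nil.
by apply: (eq_Cm _ (CmM (Cf i) IH)) => x; rewrite big_cons.
Qed.

Lemma CmX m d (f : 'rV[R]_d -> R) k : Cm m f -> Cm m (fun x => f x ^+ k).
Proof.
move=> Cf; elim: k => [|k IH]; first exact: Cm_cst.
by apply: (eq_Cm _ (CmM Cf IH)) => x; rewrite exprS.
Qed.

Lemma Cm_poly m s d (f : 'rV[R]_d -> R) : poly_fun s f -> Cm m f.
Proof.
move=> [p [_ fE]].
apply: (@eq_Cm _ _ _ (fun x => \sum_(k <- msupp p) mcoeff k p * \prod_i x ord0 i ^+ k i)).
  by move=> x; rewrite fE mevalE.
apply: Cm_sum => k; apply: CmM; first exact: Cm_cst.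
by apply: Cm_prod => i; apply: CmX; exact: Cm_coord.
Qed.

Lemma is_derive_comp_affine d1 d2 (f : 'rV[R]_d2 -> R) b (L : 'M[R]_(d1, d2)) x v :
  derivable f (b + x *m L) (v *m L) ->
  is_derive x v (fun y => f (b + y *m L)) ('D_(v *m L) f (b + x *m L)).
Proof.
have E : (fun h : R => h^-1 *: (((fun y => f (b + y *m L)) \o shift x) (h *: v) - f (b + x *m L)))
  = (fun h : R => h^-1 *: ((f \o shift (b + x *m L)) (h *: (v *m L)) - f (b + x *m L))).
  apply: funext => h; congr (_ *: (f _ - _)).
  by rewrite /= mulmxDl -scalemxAl addrCA.
by move=> d; split; [rewrite /derivable E|rewrite /derive E].
Qed.

(** The chain rule for an affine change of variables: moving along a coordinate
    of x is moving along a row of L. *)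
Lemma derive_comp_affine d1 d2 (f : 'rV[R]_d2 -> R) b (L : 'M[R]_(d1, d2)) x i :
  Cm 1 f ->
  is_derive x (basis_vec R i) (fun y => f (b + y *m L))
    (\sum_j L i j * 'D_(basis_vec R j) f (b + x *m L)).
Proof.
move=> [_ cf].
have [d D] : is_derive (b + x *m L) (basis_vec R i *m L) f
    (\sum_j (basis_vec R i *m L) ord0 j * 'D_(basis_vec R j) f (b + x *m L)).
  by apply: is_derive_dir_partials => j; have [] := cf j.
rewrite (eq_bigr (fun j => (basis_vec R i *m L) ord0 j * 'D_(basis_vec R j) f (b + x *m L))).
  by rewrite -D; exact: is_derive_comp_affine.
by move=> j _; rewrite /basis_vec -rowE mxE.
Qed.

Lemma continuous_affine d1 d2 b (L : 'M[R]_(d1, d2)) :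
  continuous (fun x : 'rV[R]_d1 => b + x *m L : 'rV[R]_d2).
Proof.
apply: continuous_add; first exact: cst_continuous.
rewrite (_ : (fun x => x *m L) = fun x => \sum_i x ord0 i *: row i L); last first.
  by apply: funext => y; exact: mulmx_sum_row.
elim: (index_enum _) => [|i s IH].
  rewrite (_ : (fun x => _) = fun=> 0); first exact: cst_continuous.
  by apply: funext => y; rewrite big_nil.
rewrite (_ : (fun x => _) =
    fun x : 'rV_d1 => x ord0 i *: row i L + \sum_(j <- s) x ord0 j *: row j L).
  by apply: continuous_add => //; apply: continuous_scalel; exact: coord_continuous.
by apply: funext => y; rewrite big_cons.
Qed.

Lemma continuous_comp_affine d1 d2 (f : 'rV[R]_d2 -> R) b (L : 'M[R]_(d1, d2)) :
  continuous f -> continuous (fun x : 'rV[R]_d1 => f (b + x *m L)).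
Proof. by move=> cf; apply: continuous_comp_fun cf; exact: continuous_affine. Qed.

Lemma Cm_comp_affine m d1 d2 (f : 'rV[R]_d2 -> R) b (L : 'M[R]_(d1, d2)) :
  Cm m f -> Cm m (fun x => f (b + x *m L)).
Proof.
elim: m f => [|m IH] f Cf.
  exact: continuous_comp_affine.
split; first exact: (continuous_comp_affine (@Cm_continuous m.+1 _ _ Cf)).
have C1 : Cm 1 f by elim: (m) Cf => // k IHk /CmW.
move=> i; split=> [x|]; first by have [] := derive_comp_affine b L x i C1.
apply: (@eq_Cm _ _ _ (fun x => \sum_j L i j * 'D_(basis_vec R j) f (b + x *m L))).
  by move=> x; have [_ ->] := derive_comp_affine b L x i C1.
apply: Cm_sum => j; apply: CmM; first exact: Cm_cst.
exact: (IH ('D_(basis_vec R j) f) (Cf.2 j).2).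
Qed.

End Smooth.

(** * Covectors in the exterior algebra and pullbacks *)

Section Exterior.
Variables (R : realType).

(** The sign such that dx_i /\ dx_J = [insert_sign i J] dx_(i |: J) for i
    outside J: the elements of J below i have to be passed. *)
Definition insert_sign d (i : 'I_d) (J : {set 'I_d}) : R :=
  (-1) ^+ #|[set q in J | (q < i)%N]|.

Lemma shuffle_sign_set1 d (i : 'I_d) (J : {set 'I_d}) :
  shuffle_sign R [set i]%SET J = insert_sign i J.
Proof.
rewrite /shuffle_sign /insert_sign; congr (_ ^+ _).
have inj : injective (pair i : 'I_d -> 'I_d * 'I_d) by move=> q1 q2 [].
rewrite -[RHS](card_imset _ inj).
apply: eq_card => -[p q]; apply/idP/imsetP => [/set_mem /= /and3P[]|[q' + [-> ->]]].
  by rewrite inE => /eqP-> qJ qi; exists q; rewrite // inE qJ.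
rewrite inE => /andP[? ?]; apply: mem_set => /=.
by apply/and3P; split => //; exact: set11.
Qed.

(** Removing i and j in either order gives opposite signs: the larger of the two
    sees the smaller one in its way or not, and the smaller never sees the larger. *)
Lemma insert_sign_swap d (i j : 'I_d) (K : {set 'I_d}) : i \in K -> j \in K -> i != j ->
  insert_sign i (K :\ i)%SET * insert_sign j (K :\ i :\ j)%SET =
  - (insert_sign j (K :\ j)%SET * insert_sign i (K :\ j :\ i)%SET).
Proof.
wlog ij : i j / (i < j)%N => [H|] iK jK.
  case: (ltngtP i j) => [|ji|/val_inj->]; last by rewrite eqxx.
    by move=> ij; apply: H.
  by rewrite eq_sym => /(H _ _ ji jK iK)->; rewrite opprK.
move=> _.
have ni : #|[set q in (K :\ i)%SET | (q < i)%N]| = #|[set q in (K :\ j :\ i)%SET | (q < i)%N]|.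
  apply: eq_card => q; rewrite !inE; case: (eqVneq q j) => [->|//].
  by rewrite [(j < i)%N]ltnNge (ltnW ij) !andbF.
have nj : #|[set q in (K :\ j)%SET | (q < j)%N]| = #|[set q in (K :\ i :\ j)%SET | (q < j)%N]|.+1.
  rewrite (cardsD1 i) !inE ij iK -(inj_eq val_inj) (ltn_eqF ij) /= add1n; congr _.+1.
  by apply: eq_card => q; rewrite !inE; do ![case: (_ == _) => //=]; rewrite ?andbT ?andbF.
by rewrite /insert_sign ni nj exprS mulN1r mulNr opprK mulrC.
Qed.

(** The common form of the double sums in d d u and in the product of a form by
    two covectors; both antisymmetries come from here. *)
Lemma insert_sum_swap d (K : {set 'I_d}) (G : 'I_d -> 'I_d -> R) :
  \sum_(i in K) insert_sign i (K :\ i)%SET *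
    (\sum_(j in (K :\ i)%SET) insert_sign j (K :\ i :\ j)%SET * G i j) =
  - \sum_(i in K) insert_sign i (K :\ i)%SET *
    (\sum_(j in (K :\ i)%SET) insert_sign j (K :\ i :\ j)%SET * G j i).
Proof.
under eq_bigr do rewrite mulr_sumr.
under [in RHS]eq_bigr do rewrite mulr_sumr.
rewrite (exchange_big_dep (mem K)) /=; last by move=> i j _; rewrite !inE => /andP[].
rewrite -sumrN; apply: eq_bigr => j jK; rewrite -sumrN.
apply: eq_big => [i|i /andP[iK]]; first by rewrite !inE jK eq_sym andbT andbC.
by rewrite !inE => /andP[ji _]; rewrite !mulrA insert_sign_swap 1?eq_sym// mulNr.
Qed.

Lemma insert_sum_symmetric d (K : {set 'I_d}) (G : 'I_d -> 'I_d -> R) :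
  (forall i j, G i j = G j i) ->
  \sum_(i in K) insert_sign i (K :\ i)%SET *
    (\sum_(j in (K :\ i)%SET) insert_sign j (K :\ i :\ j)%SET * G i j) = 0.
Proof.
move=> sG; have := insert_sum_swap K G.
under [in X in _ = - X]eq_bigr do under eq_bigr do rewrite -sG.
by move/eqP; rewrite -addr_eq0 -mulr2n mulrn_eq0 => /eqP.
Qed.

Lemma wedge_covectorE d (c : 'I_d -> R) (b : ext R d) (K : {set 'I_d}) :
  wedge (covector c) b K =
  \sum_(j in K) insert_sign j (K :\ j)%SET * (c j * b (K :\ j)%SET).
Proof.
rewrite ffunE.
under eq_bigr do rewrite ffunE mulr_sumr mulr_suml.
rewrite exchange_big /= [RHS]big_mkcond; apply: eq_bigr => j _.
have [jK|jK] := boolP (j \in K); last first.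
  apply: big1 => I IK; case: eqP => [Ij|_]; last by rewrite mul0r mulr0 mul0r.
  by rewrite Ij finset.sub1set (negPf jK) in IK.
rewrite (bigD1 [set j]%SET) ?finset.sub1set//= eqxx mul1r shuffle_sign_set1 mulrA.
rewrite big1 ?addr0// => I /andP[_ /negPf->].
by rewrite mul0r mulr0 mul0r.
Qed.

(** Products of covectors being bracketed to the right, anticommutation is stated
    for multiplications on the left: in this form it sorts the products. *)
Lemma wedge_covector_swap d (c c' : 'I_d -> R) (b : ext R d) :
  wedge (covector c) (wedge (covector c') b) =
  - wedge (covector c') (wedge (covector c) b).
Proof.
apply/ffunP => K; rewrite wedge_covectorE [RHS]ffunE wedge_covectorE.
under eq_bigr do rewrite wedge_covectorE mulr_sumr.
under [in RHS]eq_bigr do rewrite wedge_covectorE mulr_sumr.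
under eq_bigr do under eq_bigr do rewrite mulrCA.
under [in RHS]eq_bigr do under eq_bigr do rewrite mulrCA.
rewrite (insert_sum_swap K (fun i j => c i * (c' j * b (K :\ i :\ j)%SET))).
congr (- _); apply: eq_bigr => i _; congr (_ * _); apply: eq_bigr => j _.
have -> : (K :\ j :\ i = K :\ i :\ j)%SET by rewrite !finset.setDDl finset.setUC.
by ring.
Qed.

Lemma wedge_covector_sqr d (c : 'I_d -> R) (b : ext R d) :
  wedge (covector c) (wedge (covector c) b) = 0.
Proof.
have /eqP := wedge_covector_swap c c b.
rewrite -addr_eq0 => /eqP/ffunP E; apply/ffunP => K; have := E K.
by rewrite !ffunE -mulr2n => /eqP; rewrite mulrn_eq0 => /eqP.
Qed.

Lemma wedge_covectorZ d (c : 'I_d -> R) (k : R) (b : ext R d) :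
  wedge (covector c) (k *: b) = k *: wedge (covector c) b.
Proof.
apply/ffunP => K; rewrite [RHS]ffunE !wedge_covectorE -[RHS]/(k * _) mulr_sumr.
by apply: eq_bigr => j _; rewrite ffunE -[X in c j * X]/(k * b _); ring.
Qed.

Definition wedge_seq d (I : Type) (c : I -> 'I_d -> R) (s : seq I) : ext R d :=
  \big[@wedge R d / ext_one R d]_(i <- s) covector (c i).

Lemma wedge_seq_move d (I : Type) (c : I -> 'I_d -> R) i s1 s2 :
  wedge_seq c (i :: s1 ++ s2) = (-1) ^+ size s1 *: wedge_seq c (s1 ++ i :: s2).
Proof.
elim: s1 => [|j s1 IH] /=; first by rewrite scale1r.
rewrite /wedge_seq !big_cons wedge_covector_swap.
have := IH; rewrite /wedge_seq !big_cons => ->.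
by rewrite wedge_covectorZ exprS mulN1r scaleNr.
Qed.

Lemma wedge_seq_dup d (I : eqType) (c : I -> 'I_d -> R) i s :
  i \in s -> wedge_seq c (i :: s) = 0.
Proof.
rewrite /wedge_seq; elim: s => // j s IH; rewrite !big_cons inE.
have [-> _|_ /=] := eqVneq i j; first exact: wedge_covector_sqr.
move=> /IH; rewrite big_cons => E; rewrite wedge_covector_swap E.
by rewrite -[X in wedge _ X](scale0r 0) wedge_covectorZ scale0r oppr0.
Qed.

(** The pullback of dx_I. *)
Definition pull_basis m d (L : 'M[R]_(m, d)) (I : {set 'I_d}) : ext R m :=
  wedge_seq (fun i j => L j i) (enum I).

Lemma ext_pullE m d (L : 'M[R]_(m, d)) (a : ext R d) K :
  ext_pull L a K = \sum_I a I * pull_basis L I K.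
Proof. by rewrite sum_ffunE; apply: eq_bigr => I _; rewrite ffunE. Qed.

(** Inserting i in the increasing enumeration of I puts it after the elements
    smaller than i, whose number is the exponent in [insert_sign]. *)
Lemma enum_setU1 d (i : 'I_d) (I : {set 'I_d}) : i \notin I ->
  exists s1 s2, [/\ enum I = s1 ++ s2, enum (i |: I)%SET = s1 ++ i :: s2 &
    size s1 = #|[set q in I | (q < i)%N]|].
Proof.
move=> iI.
have : i \in enum (i |: I)%SET by rewrite mem_enum finset.setU11.
have : pairwise (fun p q : 'I_d => (p < q)%N) (enum (i |: I)%SET).
  rewrite -sorted_pairwise; last by move=> ? ? ?; exact: ltn_trans.
  rewrite {1}/enum_mem sorted_filter//; first by move=> ? ? ?; exact: ltn_trans.
  by have := iota_ltn_sorted 0 d; rewrite -val_enum_ord sorted_map enumT unlock.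
have enumI : enum I = [seq q <- enum (i |: I)%SET | q != i].
  rewrite /enum_mem -filter_predI; apply: eq_filter => q /=.
  by rewrite !inE; case: eqVneq => // ->; rewrite (negPf iI).
move: (enum_uniq (i |: I)%SET) => + + iU; case/splitPr: iU enumI => s1 s2 enumI.
rewrite pairwise_cat /= => U /and4P[/allrelP s12 _ /allP s2i _].
have s1i q : q \in s1 -> (q < i)%N by move=> qs; apply: s12; rewrite // mem_head.
have E : enum I = s1 ++ s2.
  rewrite enumI filter_cat /= eqxx; congr (_ ++ _); apply/all_filterP/allP => q.
    by move=> /s1i; rewrite -(inj_eq val_inj) ltn_neqAle => /andP[].
  by move=> /s2i; rewrite -(inj_eq val_inj) eq_sym ltn_neqAle => /andP[].
exists s1, s2; split => //.
have -> : #|[set q in I | (q < i)%N]| = size [seq q : 'I_d <- enum I | (q < i)%N].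
  rewrite cardE; congr size; rewrite /enum_mem -filter_predI; apply: eq_filter => q /=.
  by rewrite !inE andbC.
rewrite E filter_cat.
have -> : [seq q : 'I_d <- s1 | (q < i)%N] = s1 by apply/all_filterP/allP => q /s1i.
have -> : [seq q : 'I_d <- s2 | (q < i)%N] = [::]; last by rewrite cats0.
apply/eqP; rewrite -[_ == _]negbK -has_filter -all_predC.
by apply/allP => q /s2i iq /=; rewrite -leqNgt ltnW.
Qed.

(** The pullback is multiplicative on dx_i /\ dx_I: the covector of i is moved to
    its place in the increasing product of the covectors of I, or meets itself. *)
Lemma wedge_pull_basis m d (L : 'M[R]_(m, d)) i I :
  wedge (covector (fun j => L j i)) (pull_basis L I) =
  if i \in I then 0 else insert_sign i I *: pull_basis L (i |: I)%SET.
Proof.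
have -> : wedge (covector (fun j => L j i)) (pull_basis L I) =
  wedge_seq (fun i j => L j i) (i :: enum I) by rewrite /wedge_seq big_cons.
case: ifPn => [iI|/enum_setU1[s1 [s2 [E1 E2 s1E]]]].
  by rewrite wedge_seq_dup ?mem_enum.
by rewrite E1 wedge_seq_move s1E /pull_basis E2.
Qed.

End Exterior.

(** * The exterior derivative of smooth forms *)

Section ExtD.
Variables (R : realType).

Lemma ext_dE d (u : form R d) x (K : {set 'I_d}) :
  ext_d u x K = \sum_(i in K) insert_sign R i (K :\ i)%SET *
     'D_(basis_vec R i) (fun y => u y (K :\ i)%SET) x.
Proof. by rewrite ffunE; apply: eq_bigr => i _; rewrite shuffle_sign_set1. Qed.

Lemma smooth_ext_d d (u : form R d) : smooth u -> smooth (ext_d u).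
Proof.
move=> su K m; apply: eq_Cm (fun x => ext_dE u x K) _.
apply: Cm_sum => i; apply: CmM; first exact: Cm_cst.
exact: ((su (K :\ i)%SET m.+1).2 i).2.
Qed.

Lemma ext_d_ext_d d (u : form R d) x : smooth u -> ext_d (ext_d u) x = 0.
Proof.
move=> su; apply/ffunP => K; rewrite ext_dE [RHS]ffunE.
have du I i y : derivable (fun y => u y I) y (basis_vec R i) by exact: ((su I 1%N).2 i).1.
have ddu I i j y : derivable ('D_(basis_vec R i) (fun y => u y I)) y (basis_vec R j).
  exact: (((su I 2%N).2 i).2.2 j).1.
have cddu I i j : continuous ('D_(basis_vec R j) ('D_(basis_vec R i) (fun y => u y I))).
  exact: (((su I 2%N).2 i).2.2 j).2.
pose G i j := 'D_(basis_vec R i) ('D_(basis_vec R j) (fun y => u y (K :\ i :\ j)%SET)) x.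
rewrite -[RHS](@insert_sum_symmetric R _ K G).
  apply: eq_bigr => i iK; congr (_ * _).
  have [_ <-] := @is_derive_lincomb R _ _ (index_enum _) (mem (K :\ i)%SET)
     (fun j => insert_sign R j (K :\ i :\ j)%SET)
     (fun j => 'D_(basis_vec R j) (fun y => u y (K :\ i :\ j)%SET)) x (basis_vec R i)
     (fun j => ddu _ j i x).
  by congr (derive _ x _); apply: funext => y; rewrite ext_dE.
move=> i j; rewrite /G.
rewrite (derive_swap x (du _ j) (du _ i) (ddu _ j i) (ddu _ i j) (cddu _ j i) (cddu _ i j)).
by rewrite (_ : (K :\ j :\ i = K :\ i :\ j)%SET)// !finset.setDDl finset.setUC.
Qed.

Lemma ext_d_near0 d (u : form R d) (U : set 'rV[R]_d) :
  open U -> (forall x, U x -> u x = 0) -> forall x, U x -> ext_d u x = 0.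
Proof.
move=> oO u0 x Ux; apply/ffunP => K; rewrite ext_dE [RHS]ffunE big1// => i _.
rewrite (@near_eq_derive _ _ _ _ (cst 0)) ?derive_cst ?mulr0//.
have : nbhs x U by exact: open_nbhs_nbhs.
by apply: filterS => y /u0 ->; rewrite ffunE.
Qed.

Definition affine_pull m d (b : 'rV[R]_d) (L : 'M[R]_(m, d)) (u : form R d) : form R m :=
  fun x => ext_pull L (u (b + x *m L)).

Lemma smooth_affine_pull m d b (L : 'M[R]_(m, d)) u :
  smooth u -> smooth (affine_pull b L u).
Proof.
move=> su K k; apply: eq_Cm (fun x => ext_pullE L _ K) _.
apply: Cm_sum => I; apply: CmM; last exact: Cm_cst.
exact: (Cm_comp_affine (f := fun y => u y I)).
Qed.

(** By the chain rule, the left side is the sum over I and i of the partial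
    derivative of u_I along i times the product of the pullbacks of dx_i and dx_I.
    On the right side this product is the pullback of dx_i /\ dx_I, and the terms
    are indexed by J = i |: I. *)
Lemma ext_d_affine_pull m d b (L : 'M[R]_(m, d)) u x : smooth u ->
  ext_d (affine_pull b L u) x = affine_pull b L (ext_d u) x.
Proof.
move=> su; apply/ffunP => K; rewrite ext_dE ext_pullE.
pose z := b + x *m L.
pose D i I := 'D_(basis_vec R i) (fun y => u y I) z.
transitivity (\sum_I \sum_i D i I * wedge (covector (fun j => L j i)) (pull_basis L I) K).
  under [RHS]eq_bigr do under eq_bigr do rewrite wedge_covectorE mulr_sumr.
  under [RHS]eq_bigr do rewrite exchange_big /=.
  rewrite exchange_big /=; apply: eq_bigr => j jK.
  have E : 'D_(basis_vec R j) (fun y => affine_pull b L u y (K :\ j)%SET) x =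
     \sum_I pull_basis L I (K :\ j)%SET * (\sum_i L j i * D i I).
    have dI I := derive_comp_affine b L x j (su I 1%N).
    rewrite (_ : (fun y => _) = fun y => \sum_I pull_basis L I (K :\ j)%SET * u (b + y *m L) I).
      have [|_ ->] := @is_derive_lincomb R _ _ (index_enum _) xpredT
        (fun I => pull_basis L I (K :\ j)%SET) (fun I y => u (b + y *m L) I) x (basis_vec R j).
        by move=> I; have [] := dI I.
      by apply: eq_bigr => I _; have [_ ->] := dI I.
    by apply: funext => y; rewrite ext_pullE; apply: eq_bigr => I _; rewrite mulrC.
  rewrite E mulr_sumr; apply: eq_bigr => I _; rewrite !mulr_sumr; apply: eq_bigr => i _.
  by ring.
under eq_bigr do under eq_bigr do rewrite wedge_pull_basis.
rewrite exchange_big /=.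
under [RHS]eq_bigr do rewrite ext_dE mulr_suml.
rewrite [RHS](exchange_big_dep xpredT)//=; apply: eq_bigr => i _.
rewrite (bigID (fun I : {set 'I_d} => i \in I)) /= big1 ?add0r; last first.
  by move=> I ->; rewrite ffunE mulr0.
rewrite [RHS](reindex_onto (fun I => i |: I)%SET (fun J => J :\ i)%SET) /=; last first.
  by move=> J iJ; rewrite finset.setD1K.
apply: eq_big => [I|I iI].
  rewrite finset.setU11 /=; apply/idP/eqP => [/finset.setU1K//|<-].
  by rewrite !inE eqxx.
by rewrite (negPf iI) finset.setU1K// ffunE -[X in _ * X]/(_ * _) /D /z mulrCA mulrA.
Qed.

End ExtD.

(** * Faces of cells *)

Section Geometry.
Local Open Scope classical_set_scope.
Context {R : realType} {n : nat}.

Lemma chart_inj (T : cell R n) : injective (chart T).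
Proof.
move=> x y /addrI /(congr1 (mulmx^~ (cell_frame T)^T)).
by rewrite -!mulmxA cell_frame_orthonormal !mulmx1.
Qed.

(** A point of E has coordinates in F, and since the frame of F is orthonormal,
    [trans] computes them. *)
Lemma chart_trans (E F : cell R n) x : cell_support E `<=` cell_support F ->
  body E x -> body F (trans E F x) /\ chart F (trans E F x) = chart E x.
Proof.
move=> EF Ex; have [|y Fy yE] := EF (chart E x); first by exists x.
have -> : trans E F x = y; last by [].
by rewrite /trans -yE /chart addrAC subrr add0r -mulmxA cell_frame_orthonormal mulmx1.
Qed.

Lemma transE (E F : cell R n) x :
  trans E F x = (cell_origin E - cell_origin F) *m (cell_frame F)^T + x *m trans_lin E F.
Proof. by rewrite /trans /chart addrAC mulmxDl /trans_lin mulmxA. Qed.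

Lemma smooth_traceE (E F : cell R n) (u : form R (cell_dim F)) :
  smooth_trace E F u =
  affine_pull ((cell_origin E - cell_origin F) *m (cell_frame F)^T) (trans_lin E F) u.
Proof. by apply: funext => x; rewrite /smooth_trace transE. Qed.

Lemma face_subset (E F : cell R n) : face E F -> cell_support E `<=` cell_support F.
Proof. by move=> [_ [c ->]] x []. Qed.

(** A linear function that reaches its maximum at an interior point is constant,
    so that the face it exposes is the whole cell. *)
Lemma face_interior (E F : cell R n) y : face E F ->
  interior (body F) y -> cell_support E (chart F y) -> cell_support E = cell_support F.
Proof.
move=> EF Fy Ey; apply/seteqP; split; first exact: face_subset.
have [_ [c cE]] := EF; move: Ey; rewrite cE => -[_ ymax] p Fp; split => // q Fq.
apply: le_trans (ymax q Fq) _; have [z Fz <-] := Fp.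
pose l x := (chart F x *m c) ord0 ord0.
(* Beyond y, on the line coming from z, there are points of the cell. *)
have [t [t0 Ft]] : exists t : R, 0 < t /\ body F (y + t *: (y - z)).
  have cv : (y + t *: (y - z)) @[t --> (0 : R)^'+] --> y.
    rewrite -[X in _ --> X](_ : y + (0 : R) *: (y - z) = y); last by rewrite scale0r addr0.
    apply: cvgD; first exact: cvg_cst.
    by apply: cvgZr_tmp; apply: cvg_at_right_filter; exact: cvg_id.
  near (0 : R)^'+ => t; exists t; split; first by [].
  by near: t; exact: (cv _ Fy).
have : l (y + t *: (y - z)) <= l y by apply: ymax; exists (y + t *: (y - z)).
have -> : l (y + t *: (y - z)) = l y + t * (l y - l z).
  have chE : chart F (y + t *: (y - z)) = chart F y + t *: (chart F y - chart F z).
    by rewrite /chart opprD addrACA subrr add0r mulmxDl -scalemxAl mulmxBl addrA.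
  rewrite /l chE mulmxDl -scalemxAl mulmxBl mxE; congr (_ + _).
  by rewrite mxE; congr (_ * _); rewrite mxE; congr (_ + _); rewrite mxE.
by rewrite gerDl pmulr_rle0// subr_le0.
Unshelve. all: by end_near. Qed.

End Geometry.

Section Mesh.
Local Open Scope classical_set_scope.
Context {R : realType} {n : nat} {M : mesh R n}.

(** If E is a face of a face of T then E is contained in T, so E is its own
    intersection with T, and two cells of a mesh meet in a face of both. *)
Lemma face_trans (E F T : M) : face E F -> face F T -> face E T.
Proof.
move=> EF FT.
have ET : cell_support E `&` cell_support T = cell_support E.
  by apply/setIidl; apply: subset_trans (face_subset FT); exact: face_subset.
by have [|_] := @mesh_inter _ _ M E T; rewrite ET => //; case: EF.
Qed.

(** Otherwise E would be F by [face_interior], although the dimensions differ. *)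
Lemma facet_bdry (E F : M) x : facet E F -> body E x -> bdry F (trans E F x).
Proof.
move=> [EF dEF] Ex; have [Fx cx] := chart_trans (face_subset EF) Ex.
split => // ix; have /geom_inj EqEF : cell_support E = cell_support F.
  by apply: face_interior EF ix _; rewrite cx; exists x.
by move/eqP: dEF; rewrite EqEF -[X in X == _]addn0 -addn1 eqn_add2l.
Qed.

(** The boundary of E is contained in the boundary of F, and in its part outside
    the interior of the facet, where phi vanishes. *)
Lemma test_form_trace (E F : M) phi : facet E F ->
  test_form (bdry F `\` (trans E F @` interior (body E))) phi ->
  test_form (bdry E) (smooth_trace E F phi).
Proof.
move=> EF [sphi [U [oU bU phi0]]]; split.
  by rewrite smooth_traceE; exact: smooth_affine_pull.
exists (trans E F @^-1` U); split.
- apply: open_comp oU => x _; rewrite (funext (@transE _ _ E F)); exact: continuous_affine.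
- move=> x [Ex ix]; apply: bU; split; first exact: facet_bdry.
  move=> [y iy yx]; have Ey := interior_subset iy.
  have sub := face_subset EF.1.
  have := (chart_trans sub Ey).2; rewrite yx (chart_trans sub Ex).2 => /chart_inj xy.
  by apply: ix; rewrite xy.
- move=> x /= Ux; apply/ffunP => K; rewrite /smooth_trace ext_pullE phi0// ffunE big1// => I _.
  by rewrite ffunE mul0r.
Qed.

End Mesh.

(** * The exterior derivative on the local spaces *)

Section Forms.
Local Open Scope classical_set_scope.
Context {R : realType} {n : nat}.
Implicit Type T : cell R n.

Lemma test_form_ext_d d (S : set 'rV[R]_d) phi : test_form S phi -> test_form S (ext_d phi).
Proof.
move=> [sphi [U [oU SU phi0]]]; split; first exact: smooth_ext_d.
by exists U; split => //; exact: ext_d_near0.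
Qed.

Lemma cell_int0 T : cell_int T (fun=> 0) = 0.
Proof. by rewrite /cell_int /Rintegral integral0. Qed.

Lemma wedge0l d (a : ext R d) : wedge 0 a = 0.
Proof. by apply/ffunP => K; rewrite !ffunE big1// => I _; rewrite ffunE mulr0 mul0r. Qed.

Lemma wedge0r d (a : ext R d) : wedge a 0 = 0.
Proof. by apply/ffunP => K; rewrite !ffunE big1// => I _; rewrite ffunE mulr0. Qed.

Lemma int_wedge0l T v : int_wedge T fzero v = 0.
Proof.
by rewrite -[RHS](cell_int0 T); congr cell_int; apply: funext => x; rewrite wedge0l ffunE.
Qed.

Lemma int_wedge0r T u v : (forall x, v x = 0) -> int_wedge T u v = 0.
Proof.
move=> v0; rewrite -[RHS](cell_int0 T); congr cell_int; apply: funext => x.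
by rewrite v0 wedge0r ffunE.
Qed.

Lemma int_dot0l T v : int_dot T fzero v = 0.
Proof.
rewrite -[RHS](cell_int0 T); congr cell_int; apply: funext => x.
by rewrite /ext_dot big1// => I _; rewrite ffunE mul0r.
Qed.

Lemma int_dot0r T v : int_dot T v fzero = 0.
Proof.
rewrite -[RHS](cell_int0 T); congr cell_int; apply: funext => x.
by rewrite /ext_dot big1// => I _; rewrite ffunE mulr0.
Qed.

Lemma L2_form0 T k : L2_form T k fzero.
Proof.
split=> [x I _|I]; first by rewrite ffunE.
rewrite (_ : (fun t => _) = cst 0); last by apply: funext => t; rewrite ffunE.
split; first exact: measurable_cst.
rewrite (_ : (fun t => _) = cst 0%E); last by apply: funext => t; rewrite ffunE expr0n.
exact: integrable0.
Qed.

(** As d(du) = 0, only one term of Stokes' formula for du remains. *)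
Lemma green_wform_d T k (u : wform R (cell_dim T)) phi :
  green T (k + 1) (wform_d u) phi = (-1) ^ (k + 1) * int_wedge T (der u) (ext_d phi).
Proof. by rewrite /green int_wedge0l add0r. Qed.

Lemma green_ext_d T k (u : wform R (cell_dim T)) phi : smooth phi ->
  green T k u (ext_d phi) = int_wedge T (der u) (ext_d phi).
Proof.
by move=> sphi; rewrite /green [X in _ * X]int_wedge0r ?mulr0 ?addr0// => x; exact: ext_d_ext_d.
Qed.

Lemma space_X_wform_d T k (u : wform R (cell_dim T)) :
  space_X T k u -> space_X T (k + 1) (wform_d u).
Proof.
move=> [_ L2du Gu]; split=> [//||phi tphi]; first exact: L2_form0.
by rewrite green_wform_d -(green_ext_d k) ?Gu ?mulr0//; [exact: test_form_ext_d|case: tphi].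
Qed.

Definition wform0 d : wform R d := WForm fzero fzero.

Lemma green0 T k phi : green T k (wform0 (cell_dim T)) phi = 0.
Proof. by rewrite /green !int_wedge0l mulr0 addr0. Qed.

Lemma space_Y0 r T k : space_Y r T k (wform0 (cell_dim T)).
Proof.
split=> [|z _]; last exact: int_dot0l.
split=> [|w _]; last exact: int_wedge0l.
split=> [|phi _]; last exact: green0.
by split=> [||phi _]; [exact: L2_form0|exact: L2_form0|exact: green0].
Qed.

Lemma poly_form0 s d k : poly_form s k (@fzero R d).
Proof.
split=> [x I _|I]; first by rewrite ffunE.
exists (0 : mpoly d R); split=> [|x]; first by rewrite msize0.
by rewrite meval0 ffunE.
Qed.

Lemma space_U0 r T k : space_U r T k fzero.
Proof.
split=> [|p _]; last exact: int_dot0l.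
split; first exact: poly_form0.
rewrite (_ : koszul T fzero = fzero); first exact: poly_form0.
by apply: funext => x; apply/ffunP => I; rewrite !ffunE big1// => i _; rewrite ffunE mulr0.
Qed.

Lemma smooth_poly_form s d k (u : form R d) : poly_form s k u -> smooth u.
Proof. by move=> [_ pu] I m; exact: Cm_poly (pu I). Qed.

Lemma ext_d0 d x : ext_d (@fzero R d) x = 0.
Proof. exact: (ext_d_near0 openT). Qed.

Lemma space_W_ext_d r T k a : space_U r T (k - 1) a -> space_W r T k (ext_d a).
Proof.
by move=> Ua; exists a, fzero; split=> [//||x]; [exact: space_U0|rewrite addr0].
Qed.

Lemma space_W_U r T k b : space_U r T k b -> space_W r T k b.
Proof.
by move=> Ub; exists fzero, b; split=> [||x]; [exact: space_U0| |rewrite ext_d0 add0r].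
Qed.

Lemma space_B_wform_d r T k (u : wform R (cell_dim T)) :
  space_B r T k u -> space_B r T (k + 1) (wform_d u).
Proof.
move=> [Xu Bu]; split=> [|/Bu]; first exact: space_X_wform_d.
move=> [f [g [a [b [v [[Pf Pg df dg] Ua Ub [Zv _] [eq_u eq_du _ _]]]]]]].
(* The datum f of u takes the place of g for du. *)
exists fzero, f, fzero, fzero, (wform0 _); split; rewrite ?addrK.
- split; rewrite ?addrK//; first exact: poly_form0.
  by move=> phi _; rewrite !int_dot0l.
- exact: space_U0.
- exact: space_U0.
- exact: space_Y0.
have z0 x : fzero x = 0 :> ext R (cell_dim T) by [].
split=> [u' _|a' _|b' Ub'|v' Yv'].
- by rewrite !int_dot0l !int_wedge0r// int_dot0r !addr0.
- exact: int_wedge0l.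
- by apply: eq_du; rewrite -addrA -opprD.
have [[X0v' Zv'] orth] := Yv'; have [_ Gv'] := X0v'.
(* The term in b vanishes as U is contained in W, the term in dv by the
   orthogonality of v' to d Z_0^(k-1); the remaining one, in a, by Stokes'
   formula since d a is in W as well. *)
have := eq_u v' X0v'; rewrite orth// (Zv' b (space_W_U Ub)) !addr0.
have := Gv' a (smooth_poly_form Ua.1.1).
by rewrite /green (Zv' _ (space_W_ext_d Ua)) mulr0 addr0 => ->; rewrite addr0.
Qed.

End Forms.

(** Stokes' formula for u and d phi on F has a boundary term on E that involves
    d of the trace of phi; the latter vanishes near the boundary of E, so that
    Stokes' formula on E moves d to the trace of u.  The sign from the degree of
    du is the one of this second integration by parts. *)
Lemma facet_trace_wform_d (R : realType) (n : nat) (M : mesh R n) (E F : M) k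
    (u : wform R (cell_dim F)) (w : wform R (cell_dim E)) :
  facet E F -> space_X E k w -> facet_trace F E k u w ->
  facet_trace F E (k + 1) (wform_d u) (wform_d w).
Proof.
move=> EF [_ _ Gw] tr phi tphi; have [sphi _] := tphi.
rewrite green_wform_d -(green_ext_d k)// tr; last exact: test_form_ext_d.
have -> : smooth_trace E F (ext_d phi) = ext_d (smooth_trace E F phi).
  by apply: funext => x; rewrite !smooth_traceE ext_d_affine_pull.
have /eqP := Gw _ (test_form_trace EF tphi).
rewrite /green addr_eq0 => /eqP ->.
by rewrite expfzDr ?oppr_eq0 ?oner_eq0// expr1z; ring.
Qed.

(** * The spaces A^k(T) *)

Theorem proposition3p6 (R : realType) (n r : nat) (hr : (1 <= r)%N)
    (M : mesh R n) (T : M) (k : int) (u : wform R (cell_dim T)) :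
  space_A r T k u ->
  (exists w : forall F : M, wform R (cell_dim F),
      traces T k u w /\ forall F : M, face F T -> space_A r F k (w F)) /\
  space_A r T (k + 1)%R (wform_d u).
Proof.
move=> [w [[wT Xw tw] Bw]]; split.
  exists w; split=> // F FT; exists w; split=> [|E EF]; last exact: Bw (face_trans EF FT).
  split=> [//|E EF|E G EF GE]; first exact: Xw (face_trans EF FT).
  exact: tw (face_trans EF FT) GE.
exists (fun F => wform_d (w F)); split=> [|F FT]; last exact: space_B_wform_d (Bw F FT).
split=> [|F FT|F E FT EF]; [by rewrite wT|exact: space_X_wform_d (Xw F FT)|].
by apply: facet_trace_wform_d EF (Xw E (face_trans EF.1 FT)) (tw F E FT EF).
Qed.
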